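(* Let $q,M\in\mathbb{N}$ and $0<\lambda<1$. Let $((F_n)_{n\in\mathbb{N}},T,\alpha)$ be an SIFS system on $\mathbb{R}^q$, where $(F_n=\{f^{(n)}_i\}_{i=1}^M)_{n\in\mathbb{N}}$ has common contraction factor $\lambda$. Let $F=\{f_i\}_{i=1}^M$ be the limit IFS and $A$ its attractor. For $k\ge1$ let $$\cup S_k=\bigcup_{j_1\ldots j_k\in\{1,\ldots,M\}^k} f_{j_1}^{(k)}f_{j_2}^{(k-1)}\cdots f_{j_k}^{(1)}(\alpha(j_k)).$$ Then $\cup S_n\to A$ as $n\to\infty$ with respect to the Hausdorff metric.
   Context: Let $d$ be the Euclidean metric on $\mathbb{R}^q$. An iterated function system (IFS) is a finite indexed collection $F=\{f_i\}_{i=1}^M$ of homeomorphisms $f_i:\mathbb{R}^q\to\mathbb{R}^q$ for which there is $0<\lambda<1$ with $d(f_i(x),f_i(y))\le\lambda\, d(x,y)$ for all $x,y,i$; $\lambda$ is called a contraction factor of $F$. Its attractor is the unique non-empty compact set $A\subset\mathbb{R}^q$ with $A=\bigcup_{i=1}^M f_i(A)$. A sequential IFS (SIFS) is a sequence $(F_n=\{f_i^{(n)}\}_{i=1}^M)_{n\in\mathbb{N}}$ of $M$-element IFSs such that, for each $i$, $f_i^{(n)}$ converges uniformly on $\mathbb{R}^q$ to some $f_i$, and the limit $F=\{f_i\}_{i=1}^M$ is itself an IFS. It has common contraction factor $\lambda$ if every $F_n$ has contraction factor $\lambda$, with $\lambda$ independent of $n$. A tile is a non-empty compact subset of $\mathbb{R}^q$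 homeomorphic to the closed unit ball of $\mathbb{R}^q$. An SIFS system is a triple $((F_n)_{n\in\mathbb{N}},T,\alpha)$ where $(F_n)$ is an SIFS of $M$-element IFSs, $T$ is a finite set of tiles with $M>|T|$, and $\alpha:\{1,\ldots,M\}\to T$ is a surjection. Juxtaposition of maps denotes composition. *)

(* Defs.v *)
(* R^q is 'rV[R]_q for R : realType; its library
   topology and uniformity are the entrywise ones, i.e. those induced by the
   Euclidean metric. *)
From mathcomp Require Import all_boot all_order all_algebra.
From mathcomp Require Import finmap.
From mathcomp Require Import all_classical all_reals all_analysis.

Set Implicit Arguments.
Unset Strict Implicit.
Unset Printing Implicit Defensive.

Import Order.TTheory GRing.Theory Num.Theory.
Import numFieldNormedType.Exports.

Local Open Scope classical_set_scope.
Local Open Scope ring_scope.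

(* The norm that the library puts on row vectors is the sup norm, so the
   Euclidean metric is introduced explicitly. *)
Definition eucl_dist (R : realType) (q : nat) (x y : 'rV[R]_q) : R :=
  Num.sqrt (\sum_(i < q) (x 0 i - y 0 i) ^+ 2).

(* Extended-real valued, so that no convention for the supremum of an empty or
   unbounded set of reals is needed; it is the usual Hausdorff metric on
   non-empty compact sets. *)
Definition hausdorff_dist (R : realType) (q : nat) (A B : set 'rV[R]_q) :
    \bar R :=
  Order.max
    (ereal_sup [set ereal_inf [set (eucl_dist x y)%:E | y in B] | x in A])
    (ereal_sup [set ereal_inf [set (eucl_dist x y)%:E | x in A] | y in B]).

Definition is_homeomorphism (U V : topologicalType) (f : U -> V) : Prop :=
  continuous f /\
  exists g : V -> U, [/\ continuous g, cancel f g & cancel g f].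

Definition homeomorphic (U V : topologicalType) (A : set U) (B : set V) :
    Prop :=
  exists (f : U -> V) (g : V -> U),
    [/\ {within A, continuous f} /\ {within B, continuous g},
        set_fun A B f /\ set_fun B A g,
        {in A, cancel f g} & {in B, cancel g f}].

Definition is_contraction_factor (R : realType) (q M : nat) (lambda : R)
    (f : 'I_M -> 'rV[R]_q -> 'rV[R]_q) : Prop :=
  0 < lambda < 1 /\
  forall i x y, eucl_dist (f i x) (f i y) <= lambda * eucl_dist x y.

Definition is_IFS (R : realType) (q M : nat)
    (f : 'I_M -> 'rV[R]_q -> 'rV[R]_q) : Prop :=
  (forall i, is_homeomorphism (f i)) /\
  exists lambda : R, is_contraction_factor lambda f.

Definition is_attractor (R : realType) (q M : nat)
    (f : 'I_M -> 'rV[R]_q -> 'rV[R]_q) (A : set 'rV[R]_q) : Prop :=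
  [/\ A !=set0, compact A & A = \bigcup_(i in [set: 'I_M]) (f i @` A)].

(* [F n i] is f_i^(n); sequences are indexed by n >= 1, and [F 0] is a dummy
   that is neither constrained nor used. *)
Definition is_SIFS (R : realType) (q M : nat)
    (F : nat -> 'I_M -> 'rV[R]_q -> 'rV[R]_q)
    (f : 'I_M -> 'rV[R]_q -> 'rV[R]_q) : Prop :=
  [/\ forall n, (0 < n)%N -> is_IFS (F n),
      forall i, {uniform, (fun n => F n i) @ \oo --> f i}
    & is_IFS f].

Definition common_contraction_factor (R : realType) (q M : nat) (lambda : R)
    (F : nat -> 'I_M -> 'rV[R]_q -> 'rV[R]_q) : Prop :=
  forall n, (0 < n)%N -> is_contraction_factor lambda (F n).

Definition is_tile (R : realType) (q : nat) (t : set 'rV[R]_q) : Prop :=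
  [/\ t !=set0, compact t
    & homeomorphic t [set x : 'rV[R]_q | eucl_dist x 0 <= 1]].

(* [f] is the limit IFS of the sequence [F]. *)
Definition is_SIFS_system (R : realType) (q M : nat)
    (F : nat -> 'I_M -> 'rV[R]_q -> 'rV[R]_q)
    (f : 'I_M -> 'rV[R]_q -> 'rV[R]_q)
    (T : {fset (set 'rV[R]_q)}) (alpha : 'I_M -> T) : Prop :=
  [/\ is_SIFS F f,
      forall t : T, is_tile (val t),
      (#|` T | < M)%N
    & forall t : T, exists i, alpha i = t].

(* On the word j_1 ... j_k this is f_{j_1}^(k) f_{j_2}^(k-1) ... f_{j_k}^(1):
   the superscript of each map is the length of the word that it heads. *)
Fixpoint word_map (R : realType) (q M : nat)
    (F : nat -> 'I_M -> 'rV[R]_q -> 'rV[R]_q) (w : seq 'I_M) :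
    'rV[R]_q -> 'rV[R]_q :=
  if w is j :: w' then F (size w) j \o word_map F w' else id.

(* Meaningful for k >= 1; [set0] is a dummy value at k = 0. *)
Definition cup_S (R : realType) (q M : nat)
    (F : nat -> 'I_M -> 'rV[R]_q -> 'rV[R]_q)
    (T : {fset (set 'rV[R]_q)}) (alpha : 'I_M -> T) (k : nat) :
    set 'rV[R]_q :=
  if k is k'.+1 then
    \bigcup_(j in [set: k'.+1.-tuple 'I_M])
      (word_map F j @` val (alpha (tnth j ord_max)))
  else set0.

(* Main.v *)
(* Let S_k be the k-th union. Splitting off the first letter of a word gives
   S_(k+1) = U_i f_i^(k+1)(S_k), while A = U_i f_i(A). Hence if S_k and A are
   within Hausdorff distance c and f_i^(k+1) is uniformly e-close to f_i, then
   S_(k+1) and A are within lambda * c + e. Once e <= (1 - lambda) * eps, this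
   yields the bound D * lambda ^+ m + eps after m further steps, where D is a
   bound at the starting index; such a D exists since S_k and A are bounded. *)
Require Import Defs.
From mathcomp Require Import all_boot all_order all_algebra.
From mathcomp Require Import finmap.
From mathcomp Require Import all_classical all_reals all_analysis.
From mathcomp Require Import ring lra.
Import Order.TTheory GRing.Theory Num.Theory.
Import numFieldNormedType.Exports.
Local Open Scope classical_set_scope.
Local Open Scope ring_scope.

(** * Cauchy-Schwarz and the Euclidean distance *)

Lemma sum_cauchy_schwarz (R : realDomainType) (I : finType) (a b : I -> R) :
  (\sum_i a i * b i) ^+ 2 <= (\sum_i a i ^+ 2) * (\sum_i b i ^+ 2).
Proof.
(* Lagrange's identity *)
have lagrange : \sum_i \sum_j (a i * b j - a j * b i) ^+ 2 =
    2 * ((\sum_i a i ^+ 2) * (\sum_i b i ^+ 2) - (\sum_i a i * b i) ^+ 2).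
  rewrite mulrBr mulr_natl mulr2n {2}(mulrC (\sum_i a i ^+ 2)) expr2.
  rewrite !big_distrlr /= mulr_sumr -big_split/= -sumrB.
  apply: eq_bigr => i _; rewrite mulr_sumr -big_split/= -sumrB.
  by apply: eq_bigr => j _; ring.
have : 0 <= \sum_i \sum_j (a i * b j - a j * b i) ^+ 2.
  by apply: sumr_ge0 => i _; apply: sumr_ge0 => j _; exact: sqr_ge0.
by rewrite lagrange pmulr_rge0 ?ltr0n// subr_ge0.
Qed.

Section eucl_dist.
Context {R : realType} {q : nat}.
Implicit Types x y z : 'rV[R]_q.

Lemma eucl_dist_ge0 x y : 0 <= eucl_dist x y.
Proof. exact: sqrtr_ge0. Qed.

Lemma eucl_distC x y : eucl_dist x y = eucl_dist y x.
Proof.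
by congr Num.sqrt; apply: eq_bigr => i _; rewrite -sqrrN opprB.
Qed.

Lemma eucl_dist_triangle y x z :
  eucl_dist x z <= eucl_dist x y + eucl_dist y z.
Proof.
rewrite /eucl_dist; set a := \sum_(i < q) (x 0 i - y 0 i) ^+ 2.
set b := \sum_(i < q) (y 0 i - z 0 i) ^+ 2.
have a0 : 0 <= a by apply: sumr_ge0 => i _; exact: sqr_ge0.
have b0 : 0 <= b by apply: sumr_ge0 => i _; exact: sqr_ge0.
pose c := \sum_(i < q) (x 0 i - y 0 i) * (y 0 i - z 0 i).
have cab : c <= Num.sqrt a * Num.sqrt b.
  rewrite -sqrtrM// (le_trans (ler_norm c))// -sqrtr_sqr ler_wsqrtr//.
  exact: sum_cauchy_schwarz.
(* Both sides become square roots, so it suffices to compare squares; after expansion only the cross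
   terms differ, and these are [cab]. *)
rewrite -[leRHS]ger0_norm ?addr_ge0 ?sqrtr_ge0// -sqrtr_sqr ler_wsqrtr//.
rewrite sqrrD !sqr_sqrtr//.
have -> : \sum_(i < q) (x 0 i - z 0 i) ^+ 2 = a + c *+ 2 + b.
  rewrite /a /b /c -sumrMnl -!big_split/=.
  by apply: eq_bigr => i _; ring.
by rewrite lerD2r lerD2l lerMn2r/=.
Qed.

(** Each of the [q] squared coordinates is at most the squared sup norm. This carries compactness
    and uniform convergence, phrased with the sup norm, over to the Euclidean metric. *)
Lemma eucl_dist_le_norm x y : eucl_dist x y <= Num.sqrt q%:R * `|x - y|.
Proof.
rewrite -(normr_id (x - y)) -sqrtr_sqr -sqrtrM// ler_wsqrtr//.
rewrite mulr_natl -[X in _ *+ X](card_ord q) -sumr_const ler_sum// => i _.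
rewrite -(real_normK (num_real (_ - _))) ler_sqr ?nnegrE//.
have := le_bigmax 0 (fun ij : 'I_1 * 'I_q => `|(x - y) ij.1 ij.2|) (0, i).
by rewrite -mx_normrE !mxE.
Qed.

(** * Bounded sets and Hausdorff closeness *)

Definition eucl_bounded (B : set 'rV[R]_q) :=
  exists D, forall x, B x -> eucl_dist x 0 <= D.

Lemma compact_eucl_bounded (B : set 'rV[R]_q) : compact B -> eucl_bounded B.
Proof.
move=> /compact_bounded[D [_ BD]].
exists (Num.sqrt q%:R * (D + 1)) => x /(BD (D + 1)).
rewrite ltrDl ltr01 => /(_ isT) xD.
rewrite (le_trans (eucl_dist_le_norm _ _))// ler_wpM2l ?sqrtr_ge0//.
by rewrite subr0.
Qed.

Lemma eucl_bounded_bigcup (I : finType) (B : I -> set 'rV[R]_q) :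
  (forall i, eucl_bounded (B i)) -> eucl_bounded (\bigcup_i B i).
Proof.
move=> /choice[D BD]; exists (\big[Num.max/0]_i D i) => x [i _ /BD] xD.
exact: le_trans (le_bigmax _ _ i).
Qed.

Lemma eucl_bounded_image (g : 'rV[R]_q -> 'rV[R]_q) (L : R)
    (B : set 'rV[R]_q) :
    0 <= L -> (forall x y, eucl_dist (g x) (g y) <= L * eucl_dist x y) ->
  eucl_bounded B -> eucl_bounded (g @` B).
Proof.
move=> L0 gL [D BD]; exists (L * D + eucl_dist (g 0) 0) => _ [x Bx <-].
rewrite (le_trans (eucl_dist_triangle (g 0) _ _))// lerD2r.
by rewrite (le_trans (gL _ _))// ler_wpM2l// BD.
Qed.

(** Asking for actual witnesses is in general stronger than bounding the Hausdorff distance by [c],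
    but it passes directly to images and unions, without suprema or infima. *)
Definition hausdorff_within (c : R) (A B : set 'rV[R]_q) :=
  (forall x, A x -> exists2 y, B y & eucl_dist x y <= c) /\
  (forall y, B y -> exists2 x, A x & eucl_dist x y <= c).

Lemma hausdorff_within_bounded (A B : set 'rV[R]_q) :
    A !=set0 -> B !=set0 -> eucl_bounded A -> eucl_bounded B ->
  exists2 c, 0 <= c & hausdorff_within c A B.
Proof.
move=> [a Aa] [b Bb] [D AD] [E BE].
have ABDE x y : A x -> B y -> eucl_dist x y <= D + E.
  move=> Ax By; rewrite (le_trans (eucl_dist_triangle 0 _ _))//.
  by rewrite lerD ?AD// eucl_distC BE.
exists (D + E); first exact: le_trans (eucl_dist_ge0 a b) (ABDE _ _ Aa Bb).
by split=> [x Ax|y By]; [exists b | exists a] => //; exact: ABDE.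
Qed.

Lemma hausdorff_within_le (c d : R) (A B : set 'rV[R]_q) :
  c <= d -> hausdorff_within c A B -> hausdorff_within d A B.
Proof.
move=> cd [AB BA]; split=> [x /AB[y]|y /BA[x]] ? dc.
  by exists y => //; exact: le_trans cd.
by exists x => //; exact: le_trans cd.
Qed.

Lemma hausdorff_dist_le (c : R) (A B : set 'rV[R]_q) :
  hausdorff_within c A B -> (hausdorff_dist A B <= c%:E)%E.
Proof.
move=> [AB BA]; rewrite /hausdorff_dist ge_max; apply/andP; split.
  apply: ge_ereal_sup => _ [x /AB[y By xyc] <-]; apply: ge_ereal_inf.
  by exists (eucl_dist x y)%:E; [exists y | rewrite lee_fin].
apply: ge_ereal_sup => _ [y /BA[x Ax xyc] <-]; apply: ge_ereal_inf.
by exists (eucl_dist x y)%:E; [exists x | rewrite lee_fin].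
Qed.

(** A point of [B] keeps the second supremum from being that of the empty set; its infimum over [A]
    is nonnegative, being [+oo] if [A] is empty. *)
Lemma hausdorff_dist_ge0 (A B : set 'rV[R]_q) :
  B !=set0 -> (0 <= hausdorff_dist A B)%E.
Proof.
move=> [b Bb]; rewrite /hausdorff_dist le_max; apply/orP; right.
apply: le_ereal_sup_tmp.
exists (ereal_inf [set (eucl_dist x b)%:E | x in A]); first by exists b.
by apply/ereal_infP => _ [x _ <-]; rewrite lee_fin eucl_dist_ge0.
Qed.

Lemma hausdorff_within_union_images (M : nat) (lambda c e : R)
    (g f : 'I_M -> 'rV[R]_q -> 'rV[R]_q) (A B : set 'rV[R]_q) :
    0 <= lambda ->
    (forall i x y, eucl_dist (g i x) (g i y) <= lambda * eucl_dist x y) ->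
    (forall i x, eucl_dist (g i x) (f i x) <= e) ->
    hausdorff_within c A B ->
  hausdorff_within (lambda * c + e)
    (\bigcup_i (g i @` A)) (\bigcup_i (f i @` B)).
Proof.
move=> l0 gl gfe [AB BA].
(* The detour through [g i y] costs [lambda * c] by contraction and [e] by closeness of [g i] to
   [f i]. *)
have gf i x y : eucl_dist x y <= c ->
    eucl_dist (g i x) (f i y) <= lambda * c + e.
  move=> xyc; rewrite (le_trans (eucl_dist_triangle (g i y) _ _))// lerD//.
  by rewrite (le_trans (gl _ _ _))// ler_wpM2l.
split=> [_ [i _ [x /AB[y By xyc] <-]]|_ [i _ [y /BA[x Ax xyc] <-]]].
  by exists (f i y); [exists i => //; exists y | exact: gf].
by exists (g i x); [exists i => //; exists x | exact: gf].
Qed.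

Lemma near_uniform_eucl_dist (M : nat)
    (F : nat -> 'I_M -> 'rV[R]_q -> 'rV[R]_q)
    (f : 'I_M -> 'rV[R]_q -> 'rV[R]_q) :
    (forall i, {uniform, (fun n => F n i) @ \oo --> f i}) ->
  forall e, 0 < e ->
    \forall n \near \oo, forall i x, eucl_dist (F n i x) (f i x) <= e.
Proof.
move=> Ff e e0; apply: filter_forall => i.
(* The added 1 keeps [s] positive when [q = 0], so that the sup-norm radius [e / s] makes sense. *)
pose s := Num.sqrt q%:R + 1 : R.
have s0 : 0 < s by rewrite ltr_wpDl ?sqrtr_ge0.
pose E := [set xy : 'rV[R]_q * 'rV[R]_q | ball xy.1 (e / s) xy.2].
have entE : entourage E by apply: entourage_ball (PosNum (divr_gt0 e0 s0)).
have : \forall n \near \oo, forall x, setT x -> E (f i x, F n i x).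
  apply: (Ff i [set h | forall x, setT x -> E (f i x, h x)]).
  by apply/uniform_nbhs; exists E; split.
apply: filterS => n nE x; have := nE x I.
rewrite /E/= -ball_normE/= => /ltW fFe.
rewrite eucl_distC (le_trans (eucl_dist_le_norm _ _))//.
rewrite (@le_trans _ _ (s * (e / s)))//; last by rewrite mulrC divfK// gt_eqF.
by rewrite ler_pM ?sqrtr_ge0// lerDl.
Qed.

End eucl_dist.

(** * Recursion, non-emptiness and boundedness of the unions *)

Section cup_S.
Context {R : realType} {q M : nat}.
Variables (F : nat -> 'I_M -> 'rV[R]_q -> 'rV[R]_q).
Variables (T : {fset (set 'rV[R]_q)}) (alpha : 'I_M -> T).

Lemma cup_S1 : cup_S F alpha 1 = \bigcup_i (F 1 i @` val (alpha i)).
Proof.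
apply/seteqP; split=> [x [w _]|x [i _ xi]].
  by case/tupleP: w => i w; rewrite (tuple0 w) => xi; exists i.
by exists [tuple i].
Qed.

Lemma cup_SS k :
  cup_S F alpha k.+2 = \bigcup_i (F k.+2 i @` cup_S F alpha k.+1).
Proof.
(* Prepending a letter changes neither the last letter, which selects the tile, nor the superscripts
   in the tail, which count letters from the right. *)
have last_cons i (w : k.+1.-tuple 'I_M) :
    tnth [tuple of i :: w] ord_max = tnth w ord_max.
  by rewrite !(tnth_nth i).
apply/seteqP; split=> [x [w _]|_ [i _ [_ [w _ [x xw <-]] <-]]].
  case/tupleP: w => i w; rewrite last_cons => -[y yw <-]; exists i => //.
  exists (word_map F w y); first by exists w => //; exists y.
  by rewrite /= size_tuple.
exists [tuple of i :: w] => //; rewrite last_cons.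
by exists x => //=; rewrite size_tuple.
Qed.

Lemma cup_S_neq0 k (i : 'I_M) :
  (forall t : T, val t !=set0) -> cup_S F alpha k.+1 !=set0.
Proof.
move=> T0; have [x xi] := T0 (alpha i).
exists (word_map F (nseq k.+1 i) x), [tuple of nseq k.+1 i] => //.
by exists x; rewrite // tnth_nseq.
Qed.

Lemma eucl_bounded_cup_S (lambda : R) k :
  0 <= lambda -> common_contraction_factor lambda F ->
  (forall t : T, eucl_bounded (val t)) -> eucl_bounded (cup_S F alpha k.+1).
Proof.
move=> l0 FL Tb; elim: k => [|k IHk]; rewrite ?cup_S1 ?cup_SS;
  apply: eucl_bounded_bigcup => i; apply: (eucl_bounded_image _ lambda) => //.
  by have [_] := FL 1%N isT; exact.
by have [_] := FL k.+2 isT; exact.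
Qed.

End cup_S.

Theorem proposition3 (R : realType) (q M : nat) (lambda : R)
    (hlambda : 0 < lambda < 1)
    (F : nat -> 'I_M -> 'rV[R]_q -> 'rV[R]_q)
    (f : 'I_M -> 'rV[R]_q -> 'rV[R]_q)
    (T : {fset (set 'rV[R]_q)}) (alpha : 'I_M -> T)
    (hsys : is_SIFS_system F f alpha)
    (hF : common_contraction_factor lambda F)
    (A : set 'rV[R]_q) (hA : is_attractor f A) :
  hausdorff_dist (cup_S F alpha n) A @[n --> \oo] --> 0%E.
Proof.
have /andP[l0 l1] := hlambda.
have [[_ Ff _] Ttile _ _] := hsys.
have [A0 Acpt AE] := hA.
(* The alphabet is non-empty because [A] is; constant words then witness that the unions are
   non-empty. *)
have i0 : 'I_M by move: (A0); rewrite AE => /cid[a /cid2[i]].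
have close e : 0 < e ->
    \forall n \near \oo, hausdorff_within e (cup_S F alpha n) A.
  move=> e0; have e20 : 0 < e / 2 by rewrite divr_gt0.
  have le0 : 0 < (1 - lambda) * (e / 2) by rewrite mulr_gt0// subr_gt0.
  have [N _ FN] := near_uniform_eucl_dist _ _ _ Ff _ le0.
  (* Starting at [N.+1] avoids the dummy value of [cup_S] at 0. *)
  have [D D0 DN] : exists2 D, 0 <= D &
      hausdorff_within D (cup_S F alpha N.+1) A.
    apply: hausdorff_within_bounded => //.
    - by apply: cup_S_neq0 => // t; have [] := Ttile t.
    - apply: (eucl_bounded_cup_S _ _ _ lambda) => //; first exact: ltW.
      by move=> t; apply: compact_eucl_bounded; have [] := Ttile t.
    - exact: compact_eucl_bounded.
  (* [e / 2] is the fixed point of [c |-> lambda * c + (1 - lambda) * (e / 2)], so only the excess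
     [D] over it shrinks, by [lambda] at each step. *)
  have step m :
      hausdorff_within (D * lambda ^+ m + e / 2) (cup_S F alpha (N + m).+1) A.
    elim: m => [|m IHm].
      rewrite addn0 expr0 mulr1; apply: hausdorff_within_le DN.
      by rewrite lerDl ltW.
    rewrite addnS cup_SS AE.
    have -> : D * lambda ^+ m.+1 + e / 2 =
        lambda * (D * lambda ^+ m + e / 2) + (1 - lambda) * (e / 2).
      by rewrite exprS; ring.
    apply: hausdorff_within_union_images IHm; first exact: ltW.
    - by have [_] := hF (N + m).+2 isT.
    - by apply: FN => /=; rewrite -addnS -addnS leq_addr.
  have lcvg : D * lambda ^+ m @[m --> \oo] --> (0 : R).
    rewrite -(mulr0 D); apply: cvgMr; apply: cvg_expr.
    by rewrite ger0_norm ?ltW.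
  have [m0 _ Hm0] : \forall m \near \oo, D * lambda ^+ m <= e / 2.
    have /cvgr0Pnorm_le/(_ _ e20) := lcvg.
    by apply: filterS => m; apply: le_trans; exact: ler_norm.
  exists (N + m0).+1 => // n /= Nn.
  have [m m0m ->] : exists2 m, (m0 <= m)%N & n = (N + m).+1.
    have Nn' : (N < n)%N by rewrite (leq_trans _ Nn)// ltnS leq_addr.
    by exists (n - N.+1)%N; rewrite ?leq_subRL -?addSn ?subnKC.
  apply: hausdorff_within_le (step m).
  by rewrite [leRHS]splitr lerD2r Hm0.
(* Lying between 0 and a real bound forces the extended-real distance to be finite. *)
have fin n e : hausdorff_within e (cup_S F alpha n) A ->
    hausdorff_dist (cup_S F alpha n) A \is a fin_num /\
    `|fine (hausdorff_dist (cup_S F alpha n) A)| <= e.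
  move=> /hausdorff_dist_le; have := hausdorff_dist_ge0 (cup_S F alpha n) A A0.
  case: hausdorff_dist => [r|//|//]; rewrite !lee_fin /= => r0 re.
  by rewrite ger0_norm.
(* Convergence to 0 splits into eventual finiteness, for which closeness 1 suffices, and convergence
   of the real values. *)
apply/fine_cvgP; split.
  by apply: filterS (close 1 ltr01) => n /fin[].
apply/cvgr0Pnorm_le => e e0.
by apply: filterS (close e e0) => n /fin[].
Qed.
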